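(* Consider the collision-channel network with 2 CUs, 2 eRRHs and 2 CPs under oblivious stationary randomized (OSR) policies satisfying $b_k^{(1)}+b_k^{(2)}=1$ for $k\in\{1,2\}$, and let the total command rate $r=r_1+r_2$ be fixed. Then the policy minimizing the average AoI $J_c$ of the CUs among these policies is $$b_{mk}^{(n)}=\tfrac12,\qquad r_k=\tfrac r2\qquad(m,n,k\in\{1,2\}).$$
   Context: Time is slotted, $t=0,1,2,\dots$; $m,n,k\in\{1,2\}$ index content users (CUs), eRRHs and content providers (CPs). An OSR policy is given by $b_{mk}^{(n)}=b_k^{(n)}\in[0,1]$ (the same for all CUs) and $r_1\ge r_2$ in $[0,1]$. In slot $t$, $\beta_{mk}^{(n)}(t)\in\{0,1\}$ indicates that CU $m$ sends a request for CP $k$ to eRRH $n$; $\sum_n\beta_{mk}^{(n)}(t)\le1$ and $\Pr(\beta_{mk}^{(n)}(t)=1)=b_k^{(n)}$. $\gamma_{nk}(t)\in\{0,1\}$ with $\Pr(\gamma_{nk}(t)=1)=r_k$ is the decision of eRRH $n$ to command CP $k$ to send a new packet. The vectors $(\beta_{mk}^{(n)}(t))_n$ are independent over $m$ and $t$; the $\gamma_{nk}(t)$ are independent over $n,k,t$ and independent of the $\beta$'s. Collisions: a request for CP $k$ is successfully received at eRRH $n$ only if exactly one CU sends such a request to eRRH $n$ in that slot. AoI at the eRRHs: $g_{nk}(0)=1$, $g_{nk}(t+1)=1$ if $\gamma_{nk}(t)\sum_m\beta_{mk}^{(n)}(t)=1$, and $g_{nk}(t+1)=g_{nk}(t)+1$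 otherwise. AoI at the CUs: put $\tilde\beta_{mk}^{(n)}(t)=\beta_{mk}^{(n)}(t)\prod_{j\ne m}(1-\beta_{jk}^{(n)}(t))$. Then $h_{mk}(0)=1$; $h_{mk}(t+1)=1$ if $\tilde\beta_{mk}^{(n)}(t)\gamma_{nk}(t)=1$ for some $n$; $h_{mk}(t+1)=\min\{h_{mk}(t),g_{nk}(t)\}+1$ if $\tilde\beta_{mk}^{(n)}(t)(1-\gamma_{nk}(t))=1$ for some $n$; $h_{mk}(t+1)=h_{mk}(t)+1$ otherwise. The average AoI of CUs is $J_c=\lim_{T\to\infty}\frac1T\sum_{t=1}^T\frac14\sum_{m=1}^{2}\sum_{k=1}^{2}\mathbb{E}[h_{mk}(t)]$. *)

(* Defs.v *)
From HB Require Import structures.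
From mathcomp Require Import all_boot all_order all_algebra.
From mathcomp Require Import all_classical all_reals all_analysis.

Set Implicit Arguments.
Unset Strict Implicit.
Unset Printing Implicit Defensive.

Import Order.TTheory GRing.Theory Num.Theory.
Import numFieldNormedType.Exports.

Local Open Scope classical_set_scope.
Local Open Scope ring_scope.

(* Two content users (index m), two eRRHs (index n), two content providers
   (index k); the indices 1, 2 are ord0, ord_max. *)
Notation CU := 'I_2 (only parsing).
Notation eRRH := 'I_2 (only parsing).
Notation CP := 'I_2 (only parsing).

Section Policies.
Variable R : realType.

Record policy := Policy {
  req_prob : CU -> eRRH -> CP -> R; (* req_prob m n k is b_{mk}^{(n)} *)
  cmd_prob : CP -> R                (* cmd_prob k is r_k *)
}.

Definition osr_policy (p : policy) : Prop :=
  [/\ forall m n k, 0 <= req_prob p m n k <= 1,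
      forall m m' n k, req_prob p m n k = req_prob p m' n k,
      forall k, 0 <= cmd_prob p k <= 1
    & cmd_prob p ord_max <= cmd_prob p ord0].

Definition full_request (p : policy) : Prop :=
  forall m k, \sum_(n < 2) req_prob p m n k = 1.

Definition total_command_rate (p : policy) : R := \sum_(k < 2) cmd_prob p k.

Definition uniform_policy (r : R) : policy :=
  Policy (fun _ _ _ => 1 / 2) (fun _ => r / 2).

End Policies.

Section SamplePaths.
Variables (beta : CU -> eRRH -> CP -> nat -> bool)
          (gamma : eRRH -> CP -> nat -> bool).

Fixpoint eRRH_age (n : eRRH) (k : CP) (t : nat) : nat :=
  if t is t'.+1 then
    if (gamma n k t' * \sum_(m < 2) beta m n k t' == 1)%N then 1%N
    else (eRRH_age n k t').+1
  else 1%N.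

Definition received (m : CU) (n : eRRH) (k : CP) (t : nat) : nat :=
  (beta m n k t * \prod_(j < 2 | j != m) (1 - beta j n k t))%N.

(* Since a CU sends a request for CP k to at most one eRRH per slot, the n
   returned by [pick] is the only one satisfying its condition. *)
Fixpoint CU_age (m : CU) (k : CP) (t : nat) : nat :=
  if t is t'.+1 then
    if [exists n : eRRH, received m n k t' * gamma n k t' == 1]%N then 1%N
    else if [pick n : eRRH | received m n k t' * (1 - gamma n k t') == 1]%N
         is Some n then (minn (CU_age m k t') (eRRH_age n k t')).+1
    else (CU_age m k t').+1
  else 1%N.

End SamplePaths.

Section Independence.
Context d (T : measurableType d) (R : realType) (P : probability T R).

Definition joint_event (I : eqType) (V : Type) (X : I -> T -> V) (s : seq I)
    (E : I -> set V) : set T :=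
  \bigcap_(i in [set` s]) (X i @^-1` E i).

(* V is finite, hence discrete: every E i is an admissible event. *)
Definition mutually_independent (I : eqType) (V : finType)
    (X : I -> T -> V) : Prop :=
  forall (s : seq I) (E : I -> set V), uniq s ->
    P (joint_event X s E) = (\prod_(i <- s) P (X i @^-1` E i))%E.

(* Independence of the sigma-algebras generated by the two families, stated
   on the generating pi-systems of finite-dimensional events. *)
Definition independent_families (I J : eqType) (V W : finType)
    (X : I -> T -> V) (Y : J -> T -> W) : Prop :=
  forall (s : seq I) (E : I -> set V) (s' : seq J) (F : J -> set W),
    P (joint_event X s E `&` joint_event Y s' F) =
    (P (joint_event X s E) * P (joint_event Y s' F))%E.

End Independence.

(* The random processes generated by a policy on some probability space.  For
   each CP k, the vectors (beta_{mk}^{(n)}(t))_n are independent over (m, t);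
   nothing is assumed on the joint law of requests for different CPs. *)
Record network (R : realType) (p : policy R) := Network {
  disp : measure_display;
  Omega : measurableType disp;
  Pr : probability Omega R;
  beta : CU -> eRRH -> CP -> nat -> {RV Pr >-> bool};
  gamma : eRRH -> CP -> nat -> {RV Pr >-> bool};
  beta_le1 : forall m k t w, (\sum_(n < 2) beta m n k t w <= 1)%N;
  beta_prob : forall m n k t,
    Pr (beta m n k t @^-1` [set true]) = (req_prob p m n k)%:E;
  gamma_prob : forall n k t,
    Pr (gamma n k t @^-1` [set true]) = (cmd_prob p k)%:E;
  beta_indep : forall k : CP,
    mutually_independent Pr
      (fun (i : CU * nat) w => [ffun n : eRRH => beta i.1 n k i.2 w]);
  gamma_indep :
    mutually_independent Pr
      (fun (i : eRRH * CP * nat) w => gamma i.1.1 i.1.2 i.2 w);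
  beta_gamma_indep :
    independent_families Pr
      (fun (i : CU * eRRH * CP * nat) w => beta i.1.1.1 i.1.1.2 i.1.2 i.2 w)
      (fun (i : eRRH * CP * nat) w => gamma i.1.1 i.1.2 i.2 w)
}.

Section AverageAoI.
Variables (R : realType) (p : policy R) (N : network p).

Definition h (m : CU) (k : CP) (t : nat) (w : Omega N) : R :=
  (CU_age (fun m n k t => beta N m n k t w) (fun n k t => gamma N n k t w)
     m k t)%:R.

Definition mean_CU_age (T : nat) : \bar R :=
  ((T%:R^-1)%:E *
   \sum_(1 <= t < T.+1)
     ((1 / 4)%:E * \sum_(m < 2) \sum_(k < 2) 'E_(Pr N)[h m k t]))%E.

(* Valued in the extended reals: J_c = +oo when, for instance, some r_k = 0. *)
Definition J_c : \bar R := limn mean_CU_age.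

End AverageAoI.

(* Main.v *)
Require Import Defs.
From HB Require Import structures.
From mathcomp Require Import all_boot all_order all_algebra.
From mathcomp Require Import all_classical all_reals all_analysis.
From mathcomp Require Import measurable_realfun ring lra.
Import Order.TTheory GRing.Theory Num.Theory.
Import numFieldNormedType.Exports.
Local Open Scope classical_set_scope.
Local Open Scope ring_scope.

(** Fix a CU m and a CP k, write b = b_k^(1), r = r_k, q = b (1 - b) and
    u = 1 - r.  The requests and commands for k in successive slots are i.i.d.,
    so (h, g_1, g_2) is a Markov chain, and the expectations H of h, Y of
    min(h, g_1) + min(h, g_2) and Z of min(h, g_1, g_2) solve the triangular
    system
      Z' = 1 + (1 - 2q (1 - u^2)) Z,
      Y' = 2 + (1 - 2q + q u) Y + 2q u^2 Z,
      H' = 1 + (1 - 2q) H + q u Y.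
    Hence E[h(t)] tends to F(r) / (2q), where
      F(r) = (4/3) / (1 + r) + (1/2) / r - (1/6) / (2 - r),
    unless q r = 0, in which case E[h(t)] = t + 1.  By Cesaro, J_c is half the
    sum over k of F(r_k) / (2 q_k), or +oo.  It remains to use that q is
    maximal exactly at b = 1/2 and that F is strictly convex on ]0, 1]. *)

(** * Expectations along i.i.d. trajectories as iterates of a Markov operator *)

Definition transition {R : pzRingType} {V : finType} {X : Type} (mu : V -> R)
  (step : X -> V -> X) (f : X -> R) (x : X) : R := \sum_v mu v * f (step x v).

(** The head of a tuple is the input of the outermost transition, so induction on [n] peels it off,
    through the bijection [c] between head-tail pairs and tuples. *)
Lemma sum_trajectories (R : comPzRingType) (V : finType) (X : Type) (mu : V -> R)
    (step : X -> V -> X) (f : X -> R) (n : nat) (x : X) :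
  \sum_(p : n.-tuple V) (\prod_(v <- p) mu v) * f (foldl step x p) =
  iter n (transition mu step) f x.
Proof.
elim: n x => [|n IH] x.
  rewrite (big_pred1 [tuple]) => [|p]; last by rewrite (tuple0 p) /= eqxx.
  by rewrite big_nil mul1r.
rewrite iterS {1}/transition.
pose c (q : V * n.-tuple V) := [tuple of q.1 :: q.2].
rewrite (reindex c) /=; last first.
  exists (fun p => (thead p, [tuple of behead p])) => [[v p] _|p _] /=.
    by congr (_, _); apply/val_inj.
  by rewrite /c /= -tuple_eta.
rewrite -(pair_bigA _ (fun v (p : n.-tuple V) =>
  (\prod_(v' <- v :: p) mu v') * f (foldl step (step x v) p))) /=.
apply: eq_bigr => v _; rewrite -IH big_distrr /=.
by apply: eq_bigr => p _; rewrite big_cons mulrA.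
Qed.

(** The first [n] inputs take finitely many values, so the integrand is a finite combination of
    indicators of cylinders, with nonnegative coefficients since [f] is nonnegative. *)
Lemma expectation_trajectory d (T : measurableType d) (R : realType)
    (P : probability T R) (V : finType) (X : Type) (mu : V -> R)
    (step : X -> V -> X) (W : nat -> T -> V) (f : X -> R) (n : nat) (x : X) :
    (forall p : n.-tuple V, measurable [set w | [tuple W i w | i < n] = p]) ->
    (forall p : n.-tuple V,
      P [set w | [tuple W i w | i < n] = p] = (\prod_(v <- p) mu v)%:E) ->
    (forall x, 0 <= f x) ->
  ('E_P[fun w => f (foldl step x [tuple W i w | i < n])])%E =
  (iter n (transition mu step) f x)%:E.
Proof.
move=> mW PW f0; rewrite unlock.
pose C (p : n.-tuple V) := [set w | [tuple W i w | i < n] = p].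
transitivity (\int[P]_w
  (\sum_(p : n.-tuple V) (f (foldl step x p))%:E * (\1_(C p) w)%:E))%E.
  apply: eq_integral => w _.
  rewrite (bigD1 [tuple W i w | i < n]) //= big1 ?adde0.
    by rewrite indicE mem_set // mule1.
  move=> p /eqP pW; rewrite indicE memNset ?mule0 // => /esym; exact: pW.
rewrite ge0_integral_sum //; last 2 first.
- by move=> p; apply/measurable_funeM/measurable_EFinP; apply: measurable_indic; exact: mW.
- by move=> p w _; rewrite mule_ge0 ?lee_fin ?f0 //.
rewrite -sum_trajectories -sumEFin; apply: eq_bigr => p _.
rewrite ge0_integralZl_EFin //; last first.
  by apply/measurable_EFinP; apply: measurable_indic; exact: mW.
rewrite integral_indic ?setIT //; last exact: mW.
by rewrite [X in (_ * X)%E](PW p) -EFinM mulrC.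
Qed.

(** * Sample paths: the ages of one CU and of both eRRHs as a chain *)

Definition ages : Type := nat * nat * nat.

(* Bits of one slot: requests of the CU under study to the two eRRHs, requests of
   the other CU, commands of the two eRRHs. *)
Definition slot : finType := ((bool * bool) * (bool * bool) * (bool * bool))%type.

(** A lone request of the CU under study ([o0 && ~~ p0]) serves that CU, while a lone request of
    either CU ([o0 (+) p0]) lets a command refresh the eRRH. The minima use the ages before the
    update. *)
Definition age_step (x : ages) (v : slot) : ages :=
  let: (a, g0, g1) := x in
  let: ((o0, o1), (p0, p1), (e0, e1)) := v in
  (if o0 && ~~ p0 && e0 || o1 && ~~ p1 && e1 then 1
   else if o0 && ~~ p0 then (minn a g0).+1
   else if o1 && ~~ p1 then (minn a g1).+1
   else a.+1,
   if (o0 (+) p0) && e0 then 1 else g0.+1,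
   if (o1 (+) p1) && e1 then 1 else g1.+1)%N.

(** With two CUs, [rev_ord m] is the one other than [m]. *)
Definition slot_at (beta : 'I_2 -> 'I_2 -> 'I_2 -> nat -> bool)
    (gamma : 'I_2 -> 'I_2 -> nat -> bool) (m k : 'I_2) (t : nat) : slot :=
  ((beta m ord0 k t, beta m ord_max k t),
   (beta (rev_ord m) ord0 k t, beta (rev_ord m) ord_max k t),
   (gamma ord0 k t, gamma ord_max k t)).

Lemma ord2P (P : 'I_2 -> Prop) : P ord0 -> P ord_max -> forall i, P i.
Proof.
move=> P0 P1 [[|[|//]] i].
- by rewrite (_ : Ordinal i = ord0) //; apply/val_inj.
- by rewrite (_ : Ordinal i = ord_max) //; apply/val_inj.
Qed.

Lemma sum_ord2 (V : nmodType) (F : 'I_2 -> V) :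
  \sum_i F i = F ord0 + F ord_max.
Proof.
by rewrite big_ord_recl big_ord1 (_ : lift _ _ = ord_max) //; exact/val_inj.
Qed.

Lemma rev_ord0 : rev_ord (ord0 : 'I_2) = ord_max. Proof. exact/val_inj. Qed.
Lemma rev_ord_max : rev_ord (ord_max : 'I_2) = ord0. Proof. exact/val_inj. Qed.

Lemma receivedE (beta : 'I_2 -> 'I_2 -> 'I_2 -> nat -> bool) (m n k : 'I_2) t :
  received beta m n k t = beta m n k t && ~~ beta (rev_ord m) n k t :> nat.
Proof.
rewrite /received (big_pred1 (rev_ord m)).
  by case: (beta m n k t); case: (beta _ n k t).
by move: m; apply: ord2P => j; move: j; apply: ord2P.
Qed.

Lemma exists_ord2 (P : pred 'I_2) : [exists i, P i] = P ord0 || P ord_max.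
Proof.
apply/existsP/orP => [[i]|[]]; last 2 first.
- by exists ord0.
- by exists ord_max.
by move: i; apply: ord2P; [left|right].
Qed.

Lemma pick_ord2 (P : pred 'I_2) : ~~ (P ord0 && P ord_max) ->
  [pick i | P i] =
  if P ord0 then Some ord0 else if P ord_max then Some ord_max else None.
Proof.
move=> nP; case: pickP => [i|P0]; last by rewrite !P0.
move: nP; elim/ord2P: i => [|nP Pi].
  by move=> _ ->.
by move: nP; rewrite Pi andbT => /negbTE ->.
Qed.

Lemma addb_eq1 (x y e : bool) : (e * (x + y) == 1)%N = (x (+) y) && e.
Proof. by case: x y e => [] [] []. Qed.

Lemma foldl_age_step (beta : 'I_2 -> 'I_2 -> 'I_2 -> nat -> bool)
    (gamma : 'I_2 -> 'I_2 -> nat -> bool) (m k : 'I_2) t :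
    (forall m k t, \sum_(n < 2) beta m n k t <= 1)%N ->
  foldl age_step (1, 1, 1)%N (mkseq (slot_at beta gamma m k) t) =
  (CU_age beta gamma m k t, eRRH_age beta gamma ord0 k t,
   eRRH_age beta gamma ord_max k t).
Proof.
move=> le1; elim: t => [//|t IH].
rewrite mkseqS foldl_rcons IH /=.
have sumE n : (\sum_(m < 2) beta m n k t =
               beta m n k t + beta (rev_ord m) n k t)%N.
  rewrite sum_ord2.
  elim/ord2P: {IH} m; first by rewrite rev_ord0.
  by rewrite rev_ord_max addnC.
rewrite !sumE !addb_eq1 exists_ord2 pick_ord2 !receivedE.
  have := le1 m k t; rewrite sum_ord2.
  case: (beta m ord0 k t); case: (beta m ord_max k t) => // _;
  case: (beta _ ord0 k t); case: (beta _ ord_max k t);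
  by case: (gamma ord0 k t); case: (gamma ord_max k t).
(* Side condition of [pick_ord2]: a CU requesting from at most one eRRH is not received at both. *)
have := le1 m k t; rewrite sum_ord2.
case: (beta m ord0 k t); case: (beta m ord_max k t) => //= _;
  by rewrite mul0n ?andbF.
Qed.

(** * The law of a single slot *)

Definition request_law {R : realType} (b : R) (o : bool * bool) : R :=
  if o.1 (+) o.2 then (if o.1 then b else 1 - b) else 0.

Definition command_law {R : realType} (r : R) (e : bool) : R :=
  if e then r else 1 - r.

Definition slot_law {R : realType} (b r : R) (v : slot) : R :=
  request_law b v.1.1 * request_law b v.1.2 *
  (command_law r v.2.1 * command_law r v.2.2).

Definition at_eRRH (o : bool * bool) (n : 'I_2) : bool :=
  if n == ord0 then o.1 else o.2.

Lemma ffun_ord2P (f : 'I_2 -> bool) o :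
  ([ffun n => f n] = [ffun n => at_eRRH o n]) <-> (f ord0, f ord_max) = o.
Proof.
split=> [/ffunP H|<-].
  by have := H ord0; have := H ord_max; rewrite !ffunE /at_eRRH /= => -> ->; case: o {H}.
by apply/ffunP; apply: ord2P; rewrite !ffunE.
Qed.

Lemma preimage_false {T : Type} (f : T -> bool) :
  f @^-1` [set false] = ~` (f @^-1` [set true]).
Proof. by apply/seteqP; split=> w /=; case: (f w). Qed.

Lemma measurable_RV_bool d (T : measurableType d) (R : realType)
  (P : probability T R) (X : {RV P >-> bool}) (A : set bool) :
  measurable (X @^-1` A).
Proof. by rewrite -[_ @^-1` _]setTI; exact: measurable_funP. Qed.

Section SlotLaw.
Variables (R : realType) (p : policy R) (N : network p).
Hypotheses (osr : osr_policy p) (full : full_request p).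
Variable k : 'I_2.
Let b := req_prob p ord0 ord0 k.
Let r := cmd_prob p k.
Let P := Pr N.

Lemma req_probE m : req_prob p m ord0 k = b /\ req_prob p m ord_max k = 1 - b.
Proof.
case: osr => _ same _ _; split; first exact: same.
have := full m k; rewrite sum_ord2 (same m ord0 ord0).
by rewrite -/b => <-; rewrite [b + _]addrC addrK.
Qed.

(** The requests of a CU to the two eRRHs are disjoint events whose probabilities sum to 1. The four
    atoms are therefore the empty event, these two events, and the null complement of their
    union. *)
Lemma request_vector_law m t o :
  P ((fun w => [ffun n => beta N m n k t w]) @^-1` [set [ffun n => at_eRRH o n]])
  = (request_law b o)%:E.
Proof.
pose A n := beta N m n k t @^-1` [set true].
have mA n : measurable (A n) by exact: measurable_RV_bool.
have [PA0 PA1] : P (A ord0) = b%:E /\ P (A ord_max) = (1 - b)%:E.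
  by have [<- <-] := req_probE m; split; exact: Defs.beta_prob.
have dA w : A ord0 w -> A ord_max w -> False.
  rewrite /A /= => a0 a1; have := beta_le1 m k t w.
  by rewrite sum_ord2 a0 a1.
have PU : P (A ord0 `|` A ord_max) = 1%E.
  rewrite measureU //; last by apply/seteqP; split=> // w [/dA]/[apply].
  by rewrite [X in (X + _)%E]PA0 [X in (_ + X)%E]PA1 -EFinD addrC subrK.
have E w : ((fun w => [ffun n => beta N m n k t w]) @^-1`
   [set [ffun n => at_eRRH o n]]) w <->
   (beta N m ord0 k t w, beta N m ord_max k t w) = o.
  exact: ffun_ord2P.
case: o E => [[] []] E; rewrite /request_law /=.
- transitivity (P set0); last exact: measure0.
  congr (P _); apply/seteqP; split=> // w /E [a0 a1].
  exact: (dA w).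
- rewrite -[RHS]PA0; congr (P _); apply/seteqP; split=> w; first by move=> /E [].
  move=> a0; apply/E; rewrite [LHS]surjective_pairing /= a0.
  case a1 : (beta N m ord_max k t w) => //; exfalso; exact: (dA w).
- rewrite -[RHS]PA1; congr (P _); apply/seteqP; split=> w; first by move=> /E [].
  move=> a1; apply/E; rewrite [LHS]surjective_pairing /= a1.
  case a0 : (beta N m ord0 k t w) => //; exfalso; exact: (dA w).
- transitivity (P (~` (A ord0 `|` A ord_max))).
    congr (P _); apply/seteqP; split=> w.
      by move=> /E [a0 a1] []; rewrite /A /= ?a0 ?a1.
    move=> /= nA; apply/E; case a0 : (beta N m ord0 k t w).
      by exfalso; apply: nA; left.
    by case a1 : (beta N m ord_max k t w) => //; exfalso; apply: nA; right.
  by rewrite probability_setC ?PU ?subee //; exact: measurableU.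
Qed.

Lemma command_prob n t e :
  P (gamma N n k t @^-1` [set e]) = (command_law r e)%:E.
Proof.
case: e; first exact: gamma_prob.
rewrite preimage_false probability_setC; last exact: measurable_RV_bool.
by rewrite gamma_prob.
Qed.

End SlotLaw.

(** * The joint law of consecutive slots *)

Lemma measurable_joint_event_bool d (T : measurableType d) (R : realType)
    (P : probability T R) (I : eqType) (X : I -> {RV P >-> bool}) (s : seq I)
    (E : I -> set bool) :
  measurable (joint_event X s E).
Proof.
apply: fin_bigcap_measurable; first exact: finite_seq.
by move=> i _; exact: measurable_RV_bool.
Qed.

Section SlotProcess.
Variables (R : realType) (p : policy R) (N : network p).
Hypotheses (osr : osr_policy p) (full : full_request p).
Variables (m k : 'I_2).

Definition slot_process (t : nat) (w : Omega N) : slot :=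
  slot_at (fun m n k t => beta N m n k t w) (fun n k t => gamma N n k t w) m k t.

Section Cylinder.
Variables (n : nat) (s : n.-tuple slot).
Let v0 : slot := ((false, false), (false, false), (false, false)).
Let v i := nth v0 s i.
(** Finite index lists at which the independence assumptions are instantiated: [users] for request
    vectors, [links] for single request bits, [commands] for command bits. *)
Let users : seq ('I_2 * nat) :=
  [seq (j, i) | j <- [:: m; rev_ord m], i <- iota 0 n].
Let requests (q : 'I_2 * nat) := if q.1 == m then (v q.2).1.1 else (v q.2).1.2.
Let request_events (q : 'I_2 * nat) := [set [ffun l => at_eRRH (requests q) l]].
Let links : seq ('I_2 * 'I_2 * 'I_2 * nat) :=
  [seq (q.1, l, k, q.2) | q <- users, l <- [:: ord0; ord_max]].
Let link_events (q : 'I_2 * 'I_2 * 'I_2 * nat) :=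
  [set at_eRRH (requests (q.1.1.1, q.2)) q.1.1.2].
Let commands : seq ('I_2 * 'I_2 * nat) :=
  [seq (l, k, i) | l <- [:: ord0; ord_max], i <- iota 0 n].
Let command_events (q : 'I_2 * 'I_2 * nat) := [set at_eRRH (v q.2).2 q.1.1].
Let X (q : 'I_2 * nat) (w : Omega N) := [ffun l => beta N q.1 l k q.2 w].
Let B (q : 'I_2 * 'I_2 * 'I_2 * nat) := beta N q.1.1.1 q.1.1.2 q.1.2 q.2.
Let G (q : 'I_2 * 'I_2 * nat) := gamma N q.1.1 q.1.2 q.2.
Let C := [set w | [tuple slot_process i w | i < n] = s].

(* The same event, over single bits for the independence from the commands and
   over request vectors for the independence between CUs and slots. *)
Let links_users : joint_event (fun q w => B q w) links link_events =
                  joint_event X users request_events.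
Proof.
apply/seteqP; split=> w H q /= qu.
  apply/ffunP => l; rewrite !ffunE.
  have := H (q.1, l, k, q.2); rewrite /= /link_events /= -surjective_pairing; apply.
  apply/allpairsP; exists (q, l); split => //=.
  by elim/ord2P: l; rewrite !inE ?eqxx ?orbT.
move/allpairsP : qu => [[u l] /= [uu _ ->]] /=.
have /ffunP/(_ l) := H u uu; rewrite /request_events /link_events !ffunE /=.
by rewrite -surjective_pairing.
Qed.

Let revE : (rev_ord m == m) = false.
Proof. by elim/ord2P: m. Qed.

(** Prescribing the first [n] slots amounts to prescribing the request vectors of both CUs and the
    commands of both eRRHs in these slots. *)
Let cylinder : C = joint_event X users request_events `&`
                   joint_event (fun q w => G q w) commands command_events.
Proof.
apply/seteqP; split=> w.
  move=> Cw; have slotE i : (i < n)%N -> slot_process i w = v i.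
    by move=> ilt; rewrite /v -Cw (nth_map (Ordinal ilt)) ?size_enum_ord // nth_enum_ord.
  split=> q /=.
    move=> /allpairsP [[j i] /= [+ + ->]]; rewrite mem_iota !inE => jm /slotE E.
    rewrite /X /request_events /=; apply/ffun_ord2P; rewrite /requests /= -E.
    by case/orP: jm => /eqP ->; rewrite ?eqxx ?revE.
  move=> /allpairsP [[j i] /= [_ + ->]]; rewrite mem_iota => /slotE E.
  rewrite /G /command_events /= -E.
  by elim/ord2P: j.
move=> [H1 H2]; apply: eq_from_tnth => i; rewrite tnth_mktuple.
rewrite (tnth_nth v0) -/(v i).
have u1 : (m, i : nat) \in users.
  by apply/allpairsP; exists (m, i : nat); rewrite mem_iota !inE eqxx ltn_ord.
have u2 : (rev_ord m, i : nat) \in users.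
  by apply/allpairsP; exists (rev_ord m, i : nat); rewrite mem_iota !inE eqxx orbT ltn_ord.
have u3 l : (l, k, i : nat) \in commands.
  apply/allpairsP; exists (l, i : nat); rewrite mem_iota ltn_ord; split=> //.
  by elim/ord2P: l; rewrite !inE ?eqxx ?orbT.
have /ffun_ord2P := H1 _ u1; rewrite /requests eqxx /= => E1.
have /ffun_ord2P := H1 _ u2; rewrite /requests revE /= => E2.
have E3 : (gamma N ord0 k i w, gamma N ord_max k i w) = (v i).2.
  have := H2 _ (u3 ord0); have := H2 _ (u3 ord_max).
  by rewrite /G /command_events /at_eRRH /= => -> ->; rewrite -surjective_pairing.
by rewrite /slot_process /slot_at E1 E2 E3 -!surjective_pairing.
Qed.

Lemma measurable_slots : measurable [set w | [tuple slot_process i w | i < n] = s].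
Proof.
rewrite -/C cylinder -links_users.
by apply: measurableI; exact: (@measurable_joint_event_bool _ _ _ (Pr N)).
Qed.

(** Independence acts three times: between requests and commands, on the [links] form of the event;
    among request vectors, on the [users] form; among commands. The factors are then regrouped slot
    by slot. *)
Lemma slots_law : Pr N [set w | [tuple slot_process i w | i < n] = s] =
  (\prod_(x <- s) slot_law (req_prob p ord0 ord0 k) (cmd_prob p k) x)%:E.
Proof.
rewrite -/C cylinder -links_users.
rewrite [LHS](beta_gamma_indep N links link_events commands command_events).
rewrite links_users.
have ui : uniq users.
  apply: allpairs_uniq; rewrite ?iota_uniq //; last by move=> [? ?] [? ?] _ _ [-> ->].
  by rewrite /= inE eq_sym revE.
have uc : uniq commands.
  by apply: allpairs_uniq; rewrite ?iota_uniq // => -[? ?] [? ?] _ _ [-> ->].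
rewrite [X in (X * _)%E](beta_indep N k request_events ui).
rewrite [X in (_ * X)%E](gamma_indep N command_events uc).
rewrite !big_allpairs_dep !big_cons !big_nil /= !mule1.
have req j : (\prod_(i <- iota 0 n) Pr N (X (j, i) @^-1` request_events (j, i)))%E =
  (\prod_(i <- iota 0 n) request_law (req_prob p ord0 ord0 k) (requests (j, i)))%:E.
  by rewrite -prodEFin; apply: eq_bigr => i _; exact: request_vector_law.
have cmd l : (\prod_(i <- iota 0 n) Pr N (G (l, k, i) @^-1` command_events (l, k, i)))%E =
  (\prod_(i <- iota 0 n) command_law (cmd_prob p k) (at_eRRH (v i).2 l))%:E.
  by rewrite -prodEFin; apply: eq_bigr => i _; exact: command_prob.
rewrite [X in (X * _ * _)%E](req m) [X in (_ * X * _)%E](req (rev_ord m)).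
rewrite [X in (_ * (X * _))%E](cmd ord0) [X in (_ * (_ * X))%E](cmd ord_max).
rewrite -!EFinM -!big_split /=.
rewrite (big_nth v0) size_tuple /index_iota subn0.
congr (_%:E); apply: eq_bigr => i _.
by rewrite /requests /= eqxx revE.
Qed.

End Cylinder.
End SlotProcess.

(** * Expected ages of the chain *)

Definition initial_ages : ages := (1, 1, 1)%N.

(** Written as an iterate, the mean of [f] in slot [t] depends on [b] and [r] only, not on the
    network. *)
Definition expected_age {R : realType} (b r : R) (f : ages -> R) (t : nat) : R :=
  iter t (transition (slot_law b r) age_step) f initial_ages.

(** The observables behind H, Y and Z. A request served without a command leaves the CU with the
    smaller of its age and that of the eRRH, which brings Y into H; the same effect brings the
    triple minimum into Y, and there the system closes. *)
Definition CU_only {R : realType} (x : ages) : R := x.1.1%:R.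
Definition CU_eRRH {R : realType} (x : ages) : R :=
  (minn x.1.1 x.1.2)%:R + (minn x.1.1 x.2)%:R.
Definition freshest {R : realType} (x : ages) : R :=
  (minn (minn x.1.1 x.1.2) x.2)%:R.

Lemma expectation_h (R : realType) (p : policy R) (N : network p) (m k : 'I_2) t :
    osr_policy p -> full_request p ->
  ('E_(Pr N)[@h _ _ N m k t])%E =
  (expected_age (req_prob p ord0 ord0 k) (cmd_prob p k) CU_only t)%:E.
Proof.
move=> osr full; rewrite /expected_age.
rewrite -(@expectation_trajectory _ _ _ (Pr N) _ _ _ _ (@slot_process _ _ N m k)).
- congr ('E_ _ [ _ ])%E; apply/funext => w; rewrite /h /CU_only.
  have -> : [tuple slot_process R p N m k i w | i < t] =
      mkseq (slot_at (fun m n k t => beta N m n k t w)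
                     (fun n k t => gamma N n k t w) m k) t
      :> seq slot.
    by rewrite /mkseq -val_enum_ord -map_comp.
  by rewrite foldl_age_step // => *; exact: beta_le1.
- by move=> s; exact: measurable_slots.
- by move=> s; exact: slots_law.
- by move=> x; rewrite /CU_only.
Qed.

(** * The triangular system of recursions *)

Lemma sum_slot (R : nmodType) (F : slot -> R) :
  \sum_v F v = \sum_o \sum_o' \sum_e F (o, o', e).
Proof. by rewrite !pair_bigA /=; apply: eq_bigr => v _; case: v => -[]. Qed.

Section Recursion.
Variables (R : realType) (b r : R).
Let q := b * (1 - b).
Let u := 1 - r.
Let K := transition (slot_law b r) age_step.

(** Either both CUs choose the same eRRH, with probability b^2 + (1 - b)^2 = 1 - 2q, and all ages
    grow; or they choose different ones, with probability q for each assignment, and each eRRH gets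
    a lone request. The four inner terms are the four outcomes of the commands. *)
Lemma transitionE f a g0 g1 : K f (a, g0, g1) =
  (1 - 2 * q) * f (a.+1, g0.+1, g1.+1) +
  q * (r * r * (2 * f (1, 1, 1)%N) +
       r * u * (f (1, 1, g1.+1)%N + f ((minn a g1).+1, 1, g1.+1)%N) +
       u * r * (f ((minn a g0).+1, g0.+1, 1)%N + f (1, g0.+1, 1)%N) +
       u * u * (f ((minn a g0).+1, g0.+1, g1.+1) +
                f ((minn a g1).+1, g0.+1, g1.+1))).
Proof.
rewrite /K /transition.
have pairE (F : bool * bool -> R) : \sum_o F o =
    F (true, true) + F (true, false) + F (false, true) + F (false, false).
  transitivity (\sum_x \sum_y F (x, y)); last by rewrite !big_bool /=; ring.
  by rewrite pair_bigA /=; apply: eq_bigr => -[].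
rewrite sum_slot !pairE /slot_law /request_law /command_law /=.
rewrite !mul0r !mulr0 !mul0r /q /u; ring.
Qed.

Let minn_id2r x y : minn (minn x y) y = minn x y.
Proof. by rewrite -minnA minnn. Qed.

(** When the CUs choose different eRRHs, the triple minimum is reset to 1 as soon as one eRRH
    commands; otherwise it grows. The null term gives the shape required by
    [iter_transition_affine]. *)
Lemma transition_freshest :
  K freshest = fun x =>
    1 + (1 - 2 * q * (1 - u ^+ 2)) * freshest x + 0 * freshest x.
Proof.
apply/funext => -[[a g0] g1]; rewrite transitionE /freshest /=.
rewrite !minnSS !(minn0, min0n) (minnAC a g1 g0) !minn_id2r -!natr1 /u; ring.
Qed.

Lemma transition_CU_eRRH :
  K CU_eRRH = fun x =>
    2 + (1 - 2 * q + q * u) * CU_eRRH x + 2 * q * u ^+ 2 * freshest x.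
Proof.
apply/funext => -[[a g0] g1]; rewrite transitionE /freshest /CU_eRRH /=.
rewrite !minnSS !(minn0, min0n) (minnAC a g1 g0) !minn_id2r -!natr1 /u; ring.
Qed.

Lemma transition_CU_only :
  K CU_only = fun x => 1 + (1 - 2 * q) * CU_only x + q * u * CU_eRRH x.
Proof.
apply/funext => -[[a g0] g1]; rewrite transitionE /CU_only /CU_eRRH /=.
rewrite -!natr1 /u; ring.
Qed.

Lemma sum_slot_law : \sum_v slot_law b r v = 1.
Proof.
have := transitionE (fun=> 1) 0 0 0; rewrite /K /transition.
under eq_bigr do rewrite mulr1.
by move=> ->; rewrite /u; ring.
Qed.

(** The transition is linear and fixes constants, the slot law having total mass 1. *)
Lemma iter_transition_affine c x y (f g : ages -> R) n a :
  iter n K (fun z => c + x * f z + y * g z) a =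
  c + x * iter n K f a + y * iter n K g a.
Proof.
elim: n a => [//|n IH] a; rewrite !iterS {1 3 5}/K /transition.
under eq_bigr do rewrite IH !mulrDr mulrCA [_ * (y * _)]mulrCA.
by rewrite !big_split /= -!mulr_suml -!mulr_sumr sum_slot_law mul1r.
Qed.

Let H := expected_age b r CU_only.
Let Y := expected_age b r CU_eRRH.
Let Z := expected_age b r freshest.

Lemma expected_freshestS t : Z t.+1 = 1 + (1 - 2 * q * (1 - u ^+ 2)) * Z t.
Proof.
(* [iterSr] applies one transition to the observable itself, so that the one-step identity passes to
   the means. *)
rewrite /Z /expected_age iterSr -/K transition_freshest iter_transition_affine.
by rewrite mul0r addr0.
Qed.

Lemma expected_CU_eRRHS t :
  Y t.+1 = 2 + (1 - 2 * q + q * u) * Y t + 2 * q * u ^+ 2 * Z t.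
Proof.
by rewrite /Y /expected_age iterSr -/K transition_CU_eRRH iter_transition_affine.
Qed.

Lemma expected_CU_onlyS t : H t.+1 = 1 + (1 - 2 * q) * H t + q * u * Y t.
Proof.
by rewrite /H /expected_age iterSr -/K transition_CU_only iter_transition_affine.
Qed.

(** Here q u = q u^2 = q, and the three recursions must be solved together. *)
Lemma expected_CU_only_stale t : q * r = 0 -> H t = t.+1%:R.
Proof.
move=> qr0; suff [-> _ _] :
  [/\ H t = t.+1%:R, Y t = 2 * t.+1%:R & Z t = t.+1%:R] by [].
have quE : q * u = q by rewrite /u mulrBr qr0 subr0 mulr1.
have qu2E : q * u ^+ 2 = q by rewrite expr2 mulrA !quE.
elim: t => [|t [IHH IHY IHZ]].
  by split; rewrite /H /Y /Z /expected_age /= /CU_only /CU_eRRH /freshest //= mulr1.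
split.
- by rewrite expected_CU_onlyS quE IHH IHY -[t.+2%:R]natr1; ring.
- rewrite expected_CU_eRRHS quE -[2 * q * u ^+ 2]mulrA qu2E IHY IHZ.
  by rewrite -[t.+2%:R]natr1; ring.
- rewrite expected_freshestS -[2 * q * _]mulrA mulrBr mulr1 qu2E IHZ.
  by rewrite -[t.+2%:R]natr1; ring.
Qed.
End Recursion.

(** * Limits of the expected ages *)

Lemma affine_recurrence_cvg (R : realType) (x c : R^nat) (a l : R) :
    0 <= a -> a < 1 -> c @ \oo --> l ->
    (forall n, x n.+1 = c n + a * x n) ->
  x @ \oo --> l / (1 - a).
Proof.
move=> a0 a1 cl xS; set L := l / (1 - a).
have a1' : 0 < 1 - a by rewrite subr_gt0.
have lE : l = (1 - a) * L by rewrite /L mulrC divfK // gt_eqF.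
apply/cvgrPdist_le => eps eps0.
have e'0 : 0 < eps / 2 * (1 - a) by rewrite !mulr_gt0 // invr_gt0.
move/cvgrPdist_le : cl => /(_ _ e'0) [M _ HM].
(* The error around L obeys e' = (l - c) + a e, and the tolerance chosen for c makes eps / 2
   invariant under this map; the initial error decays geometrically. *)
have bnd j : `|L - x (M + j)%N| <= eps / 2 + a ^+ j * `|L - x M|.
  elim: j => [|j IH].
    by rewrite addn0 expr0 mul1r lerDr mulr_ge0 // ltW.
  rewrite addnS xS.
  have -> : L - (c (M + j)%N + a * x (M + j)%N) =
      (l - c (M + j)%N) + a * (L - x (M + j)%N) by rewrite lE; ring.
  apply: le_trans (ler_normD _ _) _; rewrite normrM (ger0_norm a0).
  have := HM _ (leq_addr j M) => /= Hc.
  have := ler_wpM2l a0 IH; rewrite exprS; lra.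
have : (fun j => a ^+ j * `|L - x M|) @ \oo --> (0 : R).
  rewrite -(mul0r `|L - x M|); apply: cvgMl; apply: cvg_expr.
  by rewrite ger0_norm.
have e20 : 0 < eps / 2 by rewrite mulr_gt0 // invr_gt0.
move/cvgrPdist_le => /(_ _ e20) [M' _ HM'].
exists (M + M')%N => // n /= Mn.
have Mle : (M <= n)%N by rewrite (leq_trans _ Mn) // leq_addr.
have /HM' : (M' <= n - M)%N by rewrite leq_subRL.
rewrite /= sub0r normrN => H.
have := bnd (n - M)%N; rewrite subnKC //.
have := ler_norm (a ^+ (n - M) * `|L - x M|); lra.
Qed.

Definition age_factor {R : realType} (r : R) : R :=
  4 / 3 / (1 + r) + 1 / 2 / r - 1 / 6 / (2 - r).

(** Division by zero gives a conventional value when q or r vanishes; this is the limit of the means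
    only otherwise. *)
Definition age_limit {R : realType} (b r : R) : R :=
  age_factor r / (2 * (b * (1 - b))).

(** The system is solved from Z to Y to H, each limit entering the constant term of the next
    recursion. *)
Lemma expected_CU_only_cvg (R : realType) (b r : R) :
    0 <= b <= 1 -> 0 <= r <= 1 -> b * (1 - b) * r != 0 ->
  expected_age b r CU_only @ \oo --> age_limit b r.
Proof.
move=> b01 r01; rewrite mulf_eq0 negb_or => /andP[q0 r0].
set q := b * (1 - b) in q0 *.
have qgt0 : 0 < q by rewrite lt_def q0 mulr_ge0 //; lra.
have rgt0 : 0 < r by rewrite lt_def r0; lra.
(* This keeps the three contraction coefficients nonnegative. *)
have qle : q <= 1 / 4.
  have := sqr_ge0 (b - 1 / 2); rewrite /q expr2; lra.
have r2 : 1 - (1 - r) ^+ 2 = r * (2 - r) by ring.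
have rr : 0 < r * (2 - r) <= 1 by rewrite mulr_gt0 //; first nra; lra.
pose z : R := 1 / (2 * q * (r * (2 - r))).
have Zcvg : expected_age b r freshest @ \oo --> z.
  rewrite /z -[X in _ / X](subKr 1).
  apply: (@affine_recurrence_cvg _ _ (fun=> 1)).
  - nra.
  - nra.
  - exact: cvg_cst.
  - by move=> n; rewrite expected_freshestS r2.
pose y : R := (2 + 2 * q * (1 - r) ^+ 2 * z) / (q * (1 + r)).
have Ycvg : expected_age b r CU_eRRH @ \oo --> y.
  rewrite /y (_ : q * (1 + r) = 1 - (1 - 2 * q + q * (1 - r))); last by ring.
  apply: (@affine_recurrence_cvg _ _
    (fun n => 2 + 2 * q * (1 - r) ^+ 2 * expected_age b r freshest n)).
  - nra.
  - nra.
  - by apply: cvgD; [exact: cvg_cst|apply: cvgMr].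
  - by move=> n; rewrite expected_CU_eRRHS -/q; ring.
have -> : age_limit b r = (1 + q * (1 - r) * y) / (1 - (1 - 2 * q)).
  rewrite /age_limit /age_factor -/q /y /z; field.
  by rewrite ?q0 ?r0 /=; apply/andP; split; lra.
apply: (@affine_recurrence_cvg _ _
    (fun n => 1 + q * (1 - r) * expected_age b r CU_eRRH n)).
- lra.
- lra.
- by apply: cvgD; [exact: cvg_cst|apply: cvgMr].
- by move=> n; rewrite expected_CU_onlyS -/q; ring.
Qed.

(** * Time averages and the value of [J_c] *)

Definition success_rate {R : realType} (p : policy R) (k : 'I_2) : R :=
  req_prob p ord0 ord0 k * (1 - req_prob p ord0 ord0 k) * cmd_prob p k.

Lemma cmd_prob_gt0 (R : realType) (p : policy R) (k : 'I_2) :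
  osr_policy p -> success_rate p k != 0 -> 0 < cmd_prob p k <= 1.
Proof.
move=> [_ _ r01 _]; rewrite /success_rate mulf_eq0 negb_or => /andP[_ rk].
by have /andP[rk0 ->] := r01 k; rewrite lt_def rk rk0.
Qed.

Lemma success_rate_dichotomy (R : realType) (p : policy R) :
  (exists k, success_rate p k = 0) \/ forall k, success_rate p k != 0.
Proof.
by have [/existsP[k /eqP]|/existsPn] := boolP [exists k, success_rate p k == 0];
  [left; exists k|right].
Qed.

Section MeanAge.
Variables (R : realType) (p : policy R) (N : network p).
Hypotheses (osr : osr_policy p) (full : full_request p).
Let H (k : 'I_2) := expected_age (req_prob p ord0 ord0 k) (cmd_prob p k) CU_only.

(** The means are the same for both CUs, which turns the factor 1/4 into 1/2. *)
Lemma mean_CU_ageE T : mean_CU_age N T =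
  (T%:R^-1 * \sum_(1 <= t < T.+1) (1 / 2 * (H ord0 t + H ord_max t)))%:E.
Proof.
rewrite /mean_CU_age [RHS]EFinM -sumEFin; congr (_ * _)%E.
apply: eq_bigr => t _; rewrite !sum_ord2 !expectation_h //.
by rewrite -!EFinD -!EFinM; congr (_%:E); rewrite -/(H ord0) -/(H ord_max); field.
Qed.

Lemma expected_CU_only_ge0 k t : 0 <= H k t.
Proof.
rewrite -lee_fin -(expectation_h R p N ord0 k t) //.
by apply: expectation_ge0 => w; exact: ler0n.
Qed.

Lemma mean_CU_age_cvg : (forall k, success_rate p k != 0) ->
  mean_CU_age N @ \oo -->
  (1 / 2 * \sum_k age_limit (req_prob p ord0 ord0 k) (cmd_prob p k))%:E.
Proof.
(* The average over slots 1 to n + 1 is a Cesaro mean of the sequence shifted by one. *)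
move=> qr; rewrite -cvg_shiftS.
rewrite (_ : (fun n => _) = EFin \o arithmetic_mean
  (fun t => 1 / 2 * (H ord0 t.+1 + H ord_max t.+1))); last first.
  apply/funext => T; rewrite mean_CU_ageE /=; congr (_ * _)%:E.
  by rewrite /series /= big_add1.
apply: cvg_EFin; first exact: nearW.
apply: cesaro; apply: cvgMr; rewrite sum_ord2.
have [b01 _ r01 _] := osr.
by apply: cvgD; rewrite (cvg_shiftS (H _)); apply: expected_CU_only_cvg;
  rewrite ?b01 ?r01 ?qr.
Qed.

(** One stale CP suffices: its age grows linearly and the other is nonnegative, so the average over
    T slots is at least T / 4. *)
Lemma mean_CU_age_cvgy k : success_rate p k = 0 -> mean_CU_age N @ \oo --> +oo%E.
Proof.
move=> qr0.
have lb t : t.+1%:R <= H ord0 t + H ord_max t.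
  move: k qr0; apply: ord2P => qr0.
  - by rewrite {1}/H expected_CU_only_stale // lerDl expected_CU_only_ge0.
  - by rewrite {2}/H expected_CU_only_stale // lerDr expected_CU_only_ge0.
have slb T : T%:R ^+ 2 / 4 <=
    \sum_(1 <= t < T.+1) (1 / 2 * (H ord0 t + H ord_max t)).
  elim: T => [|T IH]; first by rewrite big_geq // expr0n mul0r.
  rewrite big_nat_recr //=.
  have := lb T.+1; rewrite -(natr1 T.+1) -(natr1 T) sqrrD1.
  have := ler0n R T; lra.
apply/cvgeyPge => A.
near=> T.
rewrite mean_CU_ageE lee_fin.
have T0 : 0 < T%:R :> R by near: T; exact: nbhs_infty_gtr.
rewrite -(ler_pM2l T0) mulVKf ?gt_eqF //.
apply: le_trans (slb T); rewrite expr2 -mulrA ler_pM2l //.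
rewrite ler_pdivlMr //.
by near: T; exact: nbhs_infty_ger.
Unshelve. all: by end_near.
Qed.

(** This makes the [limn] in [J_c] a genuine limit. *)
Lemma cvg_mean_CU_age : cvgn (mean_CU_age N).
Proof.
have [[k k0]|qr] := success_rate_dichotomy R p.
- by apply/cvg_ex; exists +oo%E; exact: mean_CU_age_cvgy k0.
- by apply/cvg_ex; eexists; exact: mean_CU_age_cvg.
Qed.

Lemma J_cE : (forall k, success_rate p k != 0) -> J_c N =
  (1 / 2 * \sum_k age_limit (req_prob p ord0 ord0 k) (cmd_prob p k))%:E.
Proof. by move=> qr; apply/cvg_lim => //; exact: mean_CU_age_cvg. Qed.

Lemma J_cy k : success_rate p k = 0 -> J_c N = +oo%E.
Proof. by move=> k0; apply/cvg_lim => //; exact: mean_CU_age_cvgy k0. Qed.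
End MeanAge.

(** * Convexity of F and the effect of b *)

Lemma age_factor_gt0 (R : realType) (r : R) : 0 < r <= 1 -> 0 < age_factor r.
Proof.
move=> r01; rewrite /age_factor.
have : 0 < 4 / 3 / (1 + r) by rewrite divr_gt0 //; lra.
have : 1 / 2 <= 1 / 2 / r by rewrite ler_pdivlMr; lra.
have : 1 / 6 / (2 - r) <= 1 / 6 by rewrite ler_pdivrMr; lra.
lra.
Qed.

(** Strict convexity in quantified form; the square later forces equal command rates. *)
Lemma age_factor_midpoint (R : realType) (x y : R) : 0 < x <= 1 -> 0 < y <= 1 ->
  2 * age_factor ((x + y) / 2) + (x - y) ^+ 2 / 6 <= age_factor x + age_factor y.
Proof.
move=> x01 y01; rewrite -subr_ge0.
have [x0 y0] : 0 < x /\ 0 < y by lra.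
(* The midpoint defect of 1 / (c + r) is (x - y)^2 / ((c + x) (c + y) (2c + x + y)), and similarly
   for 1 / (2 - r). *)
have -> : age_factor x + age_factor y -
    (2 * age_factor ((x + y) / 2) + (x - y) ^+ 2 / 6) =
  (x - y) ^+ 2 * (4 / 3 / ((1 + x) * (1 + y) * (2 + x + y)) +
    1 / 2 / (x * y * (x + y)) - 1 / 6 / ((2 - x) * (2 - y) * (4 - x - y)) - 1 / 6).
  by rewrite /age_factor; field; repeat (apply/andP; split); lra.
rewrite mulr_ge0 ?sqr_ge0 //.
(* The three fractions are at least 0, at least 1/4 and at most 1/12, and 1/4 - 1/12 = 1/6. *)
have : 0 <= 4 / 3 / ((1 + x) * (1 + y) * (2 + x + y)).
  by rewrite divr_ge0 // ?mulr_ge0 //; lra.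
have : 1 / 4 <= 1 / 2 / (x * y * (x + y)).
  rewrite ler_pdivlMr ?mulr_gt0 //; last lra.
  have : x * y <= 1 by nra.
  have : 0 < x * y by nra.
  nra.
have : 1 / 6 / ((2 - x) * (2 - y) * (4 - x - y)) <= 1 / 12.
  rewrite ler_pdivrMr; last by rewrite !mulr_gt0 //; lra.
  have : 1 <= (2 - x) * (2 - y) by nra.
  nra.
lra.
Qed.

(** With d = b - 1/2 one has 4q = 1 - 4 d^2, so the limit is 2 F(r) / (1 - 4 d^2), and 1 / (1 - 4
    d^2) >= 1 + 4 d^2. *)
Lemma age_limit_ge (R : realType) (b r : R) :
    0 <= b <= 1 -> b * (1 - b) != 0 -> 0 < r <= 1 ->
  2 * age_factor r * (1 + 4 * (b - 1 / 2) ^+ 2) <= age_limit b r.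
Proof.
move=> b01 q0 r01; rewrite /age_limit.
have qgt0 : 0 < b * (1 - b) by rewrite lt_def q0 mulr_ge0 //; lra.
rewrite ler_pdivlMr; last lra.
rewrite -subr_ge0.
have -> : age_factor r - 2 * age_factor r * (1 + 4 * (b - 1 / 2) ^+ 2) *
    (2 * (b * (1 - b))) = age_factor r * (16 * ((b - 1 / 2) ^+ 2) ^+ 2) by field.
rewrite mulr_ge0 ?(ltW (age_factor_gt0 _ _ r01)) //.
by rewrite mulr_ge0 // sqr_ge0.
Qed.

(** * Minimality and uniqueness of the uniform policy *)

Section Optimality.
Variables (R : realType) (r : R).
Hypotheses (r_ge0 : 0 <= r) (r_le2 : r <= 2).

Lemma uniform_policy_admissible :
  [/\ osr_policy (uniform_policy r), full_request (uniform_policy r)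
    & total_command_rate (uniform_policy r) = r].
Proof.
have half : 1 / 2 + 1 / 2 = 1 :> R by lra.
split.
- split=> [m n k|m m' n k|k|] //=; apply/andP; split; try lra.
  + by rewrite divr_ge0.
  + by rewrite ler_pdivrMr // mul1r.
- by move=> m k; rewrite sum_ord2.
- by rewrite /total_command_rate sum_ord2 /= -splitr.
Qed.

Lemma J_c_uniform (N : network (uniform_policy r)) : 0 < r ->
  J_c N = (2 * age_factor (r / 2))%:E.
Proof.
move=> r0; have [osr full _] := uniform_policy_admissible.
rewrite J_cE //; first by congr (_%:E); rewrite sum_ord2 /age_limit /=; field.
by move=> k; rewrite /success_rate /= !mulf_neq0 //; lra.
Qed.

(** Half the sum of the bounds of [age_limit_ge], followed by the midpoint inequality. Minimality
    drops the nonnegative penalties; uniqueness makes them vanish. *)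
Lemma J_c_gap (p : policy R) (N : network p) :
    osr_policy p -> full_request p -> total_command_rate p = r ->
    (forall k, success_rate p k != 0) ->
  exists2 j, J_c N = j%:E &
    2 * age_factor (r / 2) + (cmd_prob p ord0 - cmd_prob p ord_max) ^+ 2 / 6 +
    4 * \sum_k age_factor (cmd_prob p k) * (req_prob p ord0 ord0 k - 1 / 2) ^+ 2 <= j.
Proof.
move=> osr full <- qr; rewrite J_cE //; eexists; first by [].
have [b01 _ _ _] := osr.
have rgt0 k : 0 < cmd_prob p k <= 1 by exact: cmd_prob_gt0.
have lim k : 2 * age_factor (cmd_prob p k) *
    (1 + 4 * (req_prob p ord0 ord0 k - 1 / 2) ^+ 2) <=
    age_limit (req_prob p ord0 ord0 k) (cmd_prob p k).
  apply: age_limit_ge; rewrite ?b01 ?rgt0 //.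
  by have := qr k; rewrite /success_rate mulf_eq0 negb_or => /andP[].
have := age_factor_midpoint _ _ _ (rgt0 ord0) (rgt0 ord_max).
rewrite /total_command_rate !sum_ord2.
have := lim ord0; have := lim ord_max; lra.
Qed.

End Optimality.

Theorem proposition2 (R : realType) (r : R) (r_ge0 : 0 <= r) (r_le2 : r <= 2) :
  let admissible (p : policy R) :=
    [/\ osr_policy p, full_request p & total_command_rate p = r] in
  let pstar := uniform_policy r in
  [/\ admissible pstar,
      (forall (p : policy R) (N : network p), admissible p ->
         cvgn (mean_CU_age N)),
      (forall (p : policy R) (N : network p) (Nstar : network pstar),
         admissible p -> (J_c Nstar <= J_c N)%E)
    & (0 < r ->
       forall (p : policy R) (N : network p) (Nstar : network pstar),
         admissible p -> (J_c N <= J_c Nstar)%E ->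
         (forall m n k, req_prob p m n k = 1 / 2) /\
         (forall k, cmd_prob p k = r / 2))].
Proof.
move=> admissible pstar.
split.
- exact: uniform_policy_admissible.
- by move=> p N [osr full _]; exact: cvg_mean_CU_age.
- move=> p N Nstar adm; have [osr full tot] := adm.
  have [[k k0]|qr] := success_rate_dichotomy R p.
    by rewrite (J_cy _ _ N osr full k k0) leey.
  have rk k := cmd_prob_gt0 _ _ k osr (qr k).
  have r0 : 0 < r.
    rewrite -tot /total_command_rate sum_ord2.
    by have := rk ord0; have := rk ord_max; lra.
  have [j -> ] := J_c_gap _ _ _ N osr full tot qr.
  rewrite J_c_uniform // lee_fin; apply: le_trans; rewrite -addrA lerDl.
  rewrite addr_ge0 ?divr_ge0 ?sqr_ge0 // mulr_ge0 // sumr_ge0 // => k _.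
  by rewrite mulr_ge0 ?sqr_ge0 // ltW // age_factor_gt0.
- move=> r0 p N Nstar adm; have [osr full tot] := adm.
  rewrite (J_c_uniform _ _ _ _ Nstar) //.
  (* A vanishing rate gives +oo, which is not below the finite optimum. *)
  have [[k k0]|qr] := success_rate_dichotomy R p.
    by rewrite (J_cy _ _ N osr full k k0).
  have rk k := cmd_prob_gt0 _ _ k osr (qr k).
  have [j -> gap] := J_c_gap _ _ _ N osr full tot qr; rewrite lee_fin => jle.
  have Fd k : 0 <= age_factor (cmd_prob p k) * (req_prob p ord0 ord0 k - 1 / 2) ^+ 2.
    by rewrite mulr_ge0 ?sqr_ge0 // ltW // age_factor_gt0.
  move: gap; rewrite sum_ord2.
  have := Fd ord0; have := Fd ord_max.
  have := sqr_ge0 (cmd_prob p ord0 - cmd_prob p ord_max) => d0 F1 F0 gap.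
  (* The penalties are nonnegative with sum at most 0, so each is 0. *)
  have /eqP : (cmd_prob p ord0 - cmd_prob p ord_max) ^+ 2 = 0 by lra.
  rewrite sqrf_eq0 subr_eq0 => /eqP rE.
  have half k : req_prob p ord0 ord0 k = 1 / 2.
    have : age_factor (cmd_prob p k) * (req_prob p ord0 ord0 k - 1 / 2) ^+ 2 = 0.
      by move: k; apply: ord2P; lra.
    move/eqP; rewrite mulf_eq0 gt_eqF ?age_factor_gt0 //= sqrf_eq0 subr_eq0.
    by move/eqP.
  split.
  + move=> m n k; have [e0 e1] := req_probE _ _ osr full k m.
    by move: n; apply: ord2P; rewrite ?e0 ?e1 half; lra.
  + move: tot; rewrite /total_command_rate sum_ord2 => tot.
    by apply: ord2P; lra.
Qed.
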